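(* Let $\theta>0$ and, for $x>0$, let $X(t)=x-N_t$, where $N_t$ is a homogeneous Poisson process with intensity $\theta$ and $N_0=0$. Let $\tau(x)=\inf\{t>0: X(t)\le 0\}$ and $A(x)=\int_0^{\tau(x)}X(t)\,dt$, and set $V(x)=E[\tau(x)A(x)]$. Then $V$ is the solution of the following problem, i.e. it satisfies $$\theta\,[V(x-1)-V(x)]=-x\,E[\tau(x)]-E[A(x)]\quad\text{for all }x>0,$$ $$V(y)=0\quad\text{for all }y\le 0,$$ and, for each fixed $x$, $\lim_{\theta\to+\infty}V(x)=0$ (with $V(x)=V(x;\theta)$ regarded as a function of the intensity $\theta$).
   Context: For a starting point $y\le 0$ the convention is $\tau(y)=0$ and $A(y)=0$. $\tau(x)$ is the first-passage time below zero and $A(x)$ the first-passage area of the process $X(t)=x-N_t$; $\tau(x)$ is finite with probability one. *)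

(* Defs.v *)
From HB Require Import structures.
From mathcomp Require Import all_boot all_order all_algebra.
From mathcomp Require Import all_classical all_reals all_analysis.

Set Implicit Arguments.
Unset Strict Implicit.
Unset Printing Implicit Defensive.

Import Order.TTheory GRing.Theory Num.Theory.
Import numFieldNormedType.Exports.

Local Open Scope classical_set_scope.
Local Open Scope ring_scope.

(* Since B i may be the whole space, the product rule for the full family
   contains the product rules for its subfamilies. *)
Definition mutually_independent (R : realType) (d d' : measure_display)
    (T : measurableType d) (T' : measurableType d') (P : probability T R)
    (n : nat) (Y : 'I_n -> T -> T') : Prop :=
  forall B : 'I_n -> set T', (forall i, measurable (B i)) ->
    P (\bigcap_(i in [set: 'I_n]) (Y i @^-1` B i))
      = (\prod_(i < n) P (Y i @^-1` B i))%E.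

(* Only times t >= 0 are constrained. The truncated subtraction on nat is the
   true increment because paths are nondecreasing; monotone right-continuous
   paths have left limits. *)
Record poisson_process (R : realType) (d : measure_display)
    (T : measurableType d) (P : probability T R) (theta : R)
    (N : R -> T -> nat) : Prop := PoissonProcess {
  pp_measurable : forall t, 0 <= t -> measurable_fun setT (N t);
  pp_start : forall w, N 0 w = 0%N;
  pp_nondecreasing : forall w s t, 0 <= s -> s <= t -> (N s w <= N t w)%N;
  pp_right_continuous : forall w t, 0 <= t -> N s w @[s --> t^'+] --> N t w;
  pp_increment_law : forall s t (k : nat), 0 <= s -> s < t ->
    P [set w | (N t w - N s w)%N = k] = (poisson_pmf (theta * (t - s)) k)%:E;
  pp_independent_increments : forall (n : nat) (u : nat -> R), 0 <= u 0%N ->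
    (forall i, u i <= u i.+1) ->
    mutually_independent P
      (fun (i : 'I_n) (w : T) => (N (u i.+1) w - N (u i) w)%N) }.

Section first_passage.
Context (R : realType) (d : measure_display) (T : measurableType d).
Variables (P : probability T R) (N : R -> T -> nat).

Definition proc (x t : R) (w : T) : R := x - (N t w)%:R.

(* +oo when the path never reaches the nonpositive half-line. *)
Definition tau (x : R) (w : T) : \bar R :=
  if x <= 0 then 0%E
  else ereal_inf [set t%:E | t in [set t | 0 < t /\ proc x t w <= 0]].

Definition area (x : R) (w : T) : \bar R :=
  if x <= 0 then 0%E
  else (\int[lebesgue_measure]_(t in [set t : R | (0 <= t)%R /\
          (t%:E <= tau x w)%E]) (proc x t w)%:E)%E.

Definition Etau (x : R) : \bar R := (\int[P]_w tau x w)%E.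

Definition Earea (x : R) : \bar R := (\int[P]_w area x w)%E.

Definition V (x : R) : \bar R := (\int[P]_w (tau x w * area x w))%E.

End first_passage.

(* Main.v *)
(** Let m be the least natural number with x <= m, and let T_k be the Lebesgue
measure of the times t > 0 with N_t < k, i.e. the k-th arrival time.  Then
tau(x) = T_m, and writing m = n + 1 the area under the decreasing staircase is
A(x) = (x - n) T_(n+1) + T_1 + ... + T_n.  Hence only the moments of the T_k
are needed.  By Tonelli, E[T_k h] is the integral over t > 0 of
E[h; N_t < k].  Applied once this gives E[T_k] = k / theta, and applied twice
it reduces E[T_k T_n] to the joint law of (N_t, N_s), which gives
E[T_k T_n] = k (n + 1) / theta^2 for k <= n.  So
V(x) = (m + 1) S / theta^2 and E[A(x)] = S / theta with
S = (x - n) m + 1 + ... + n, and the difference equation is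
the recursion S_(m+1)(x) = S_m(x - 1) + x. *)
Require Import Defs.
From HB Require Import structures.
From mathcomp Require Import all_boot all_order all_algebra.
From mathcomp Require Import all_classical all_reals all_analysis.
From mathcomp Require Import measurable_realfun ring lra.

Set Implicit Arguments.
Unset Strict Implicit.
Unset Printing Implicit Defensive.

Import Order.TTheory GRing.Theory Num.Theory.
Import numFieldNormedType.Exports.

Local Open Scope classical_set_scope.
Local Open Scope ring_scope.

(** * Poisson weights: derivatives, decay and integrals over a half-line *)

(* [poisson_pmf] has the junk value 1 at rates <= 0; this analytic extension is
   differentiable at [s = a], as the fundamental theorem of calculus needs. *)
Definition shifted_pmf (R : realType) (theta a : R) (j : nat) (s : R) : R :=
  (theta * (s - a)) ^+ j * j`!%:R^-1 * expR (- (theta * (s - a))).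

Lemma shifted_pmfE (R : realType) (theta a : R) j s : 0 < theta -> a < s ->
  poisson_pmf (theta * (s - a)) j = shifted_pmf theta a j s.
Proof. by move=> t0 as_; rewrite /poisson_pmf mulr_gt0// subr_gt0. Qed.

Lemma shifted_pmf_ge0 (R : realType) (theta a : R) j s : 0 < theta -> a <= s ->
  0 <= shifted_pmf theta a j s.
Proof.
move=> t0 as_; rewrite /shifted_pmf !mulr_ge0 ?expR_ge0// exprn_ge0//.
by rewrite mulr_ge0 ?subr_ge0// ltW.
Qed.

Lemma is_derive_shifted_pmf0 (R : realType) (theta a s : R) :
  is_derive s 1 (shifted_pmf theta a 0) (- theta * shifted_pmf theta a 0 s).
Proof.
rewrite /shifted_pmf; under eq_fun do rewrite expr0 fact0 invr1 !mul1r.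
apply: is_derive_eq; rewrite expr0 fact0 divr1 /GRing.scale/=.
by ring.
Qed.

(** These are the forward equations of the Poisson process; they make sums of consecutive weights
    telescope under differentiation. *)
Lemma is_derive_shifted_pmfS (R : realType) (theta a : R) j (s : R) :
  is_derive s 1 (shifted_pmf theta a j.+1)
    (theta * (shifted_pmf theta a j s - shifted_pmf theta a j.+1 s)).
Proof.
pose u (s : R) := theta * (s - a).
have du : is_derive s 1 u theta.
  by apply: is_derive_eq; rewrite /GRing.scale/=; ring.
have dX : is_derive s 1 (fun s => u s ^+ j.+1) (j.+1%:R * u s ^+ j * theta).
  by rewrite -[X in is_derive _ _ X]exprfctE; apply: is_derive_eq.
rewrite /shifted_pmf; apply: is_derive_eq.
rewrite /GRing.scale/= factS natrM exprS -/(u s).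
have : j.+1%:R != 0 :> R by rewrite pnatr_eq0.
have : j`!%:R != 0 :> R by rewrite pnatr_eq0 -lt0n fact_gt0.
move: j.+1%:R j`!%:R => x y y0 x0. by field; rewrite y0.
Qed.

(** With [u = theta * (s - a)], the bound [u^(j+1) / (j+1)! <= expR u] makes the weight at most
    [(j+1) / u], hence at most [e] once [u >= (j+1) / e]. *)
Lemma cvg_shifted_pmf (R : realType) (theta a : R) j : 0 < theta ->
  shifted_pmf theta a j s @[s --> +oo] --> 0.
Proof.
move=> t0; apply/cvgrPdist_le => /= e e0; near=> s.
have as_ : a < s by near: s; apply: nbhs_pinfty_gt; exact: num_real.
rewrite sub0r normrN ger0_norm; last exact: shifted_pmf_ge0 t0 (ltW as_).
have u0 : 0 < theta * (s - a) by rewrite mulr_gt0// subr_gt0.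
have ue : j.+1%:R / e <= theta * (s - a).
  rewrite -ler_pdivrMl// lerBrDr.
  by near: s; apply: nbhs_pinfty_ge; exact: num_real.
rewrite /shifted_pmf; move: (theta * (s - a)) u0 ue => u u0 ue.
rewrite expRN ler_pdivrMr ?expR_gt0//.
apply: le_trans (_ : _ <= e * (u ^+ j.+1 / j.+1`!%:R)) _; last first.
  rewrite ler_pM2l//; apply: le_trans (expR_ge1Dxn j (ltW u0)).
  by rewrite lerDr.
rewrite ler_pdivrMr// in ue.
rewrite factS natrM exprS invfM.
rewrite [leRHS](_ : _ = (u * e / j.+1%:R) * (u ^+ j / j`!%:R)); last by ring.
apply: ler_peMl; first by rewrite divr_ge0// exprn_ge0// ltW.
by rewrite ler_pdivlMr ?ltr0n// mul1r.
Unshelve. all: by end_near. Qed.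

Lemma continuous_shifted_pmf (R : realType) (theta a : R) j :
  continuous (shifted_pmf theta a j).
Proof.
case: j => [|j] s; apply: differentiable_continuous; apply/derivable1_diffP.
  by have [] := is_derive_shifted_pmf0 theta a s.
by have [] := is_derive_shifted_pmfS theta a j s.
Qed.

Lemma measurable_shifted_pmf (R : realType) (theta a : R) j (D : set R) :
  measurable D -> measurable_fun D (shifted_pmf theta a j).
Proof.
move=> mD; apply: measurable_funTS; apply: continuous_measurable_fun.
exact: continuous_shifted_pmf.
Qed.

(** By the forward equations the derivative of the partial sum telescopes to [- theta] times its
    last weight, which yields an explicit primitive. *)
Lemma is_derive_sum_shifted_pmf (R : realType) (theta a : R) j (s : R) :
  theta != 0 ->
  is_derive s 1 (fun s => - theta^-1 * \sum_(i < j.+1) shifted_pmf theta a i s)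
    (shifted_pmf theta a j s).
Proof.
move=> t0; elim: j => [|j IH].
  under eq_fun do rewrite big_ord1.
  have d0 := is_derive_shifted_pmf0 theta a s.
  by apply: is_derive_eq; rewrite /GRing.scale/=; field.
under eq_fun do rewrite big_ord_recr mulrDr/=.
have d1 := is_derive_shifted_pmfS theta a j s.
by apply: is_derive_eq; rewrite /GRing.scale/=; field.
Qed.

Lemma integral_shifted_pmf (R : realType) (theta a : R) j : 0 < theta ->
  (\int[lebesgue_measure]_(s in `]a, +oo[) (shifted_pmf theta a j s)%:E
    = theta^-1%:E)%E.
Proof.
move=> t0; have tn0 : theta != 0 by rewrite gt_eqF.
rewrite integral_itv_obnd_cbnd//; last first.
  by apply/measurable_EFinP; exact: measurable_shifted_pmf.
pose F s := - theta^-1 * \sum_(i < j.+1) shifted_pmf theta a i s.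
have dF (s : R) : is_derive s 1 F (shifted_pmf theta a j s).
  exact: is_derive_sum_shifted_pmf.
(* At [s = a] only the weight of index 0 survives, with value 1. At infinity the primitive tends to
   0, so the integral is [theta^-1]. *)
have Fa : F a = - theta^-1.
  rewrite /F big_ord_recl big1 ?addr0.
    by rewrite /shifted_pmf subrr mulr0 expr0 oppr0 expR0 fact0 invr1 !mulr1.
  by move=> i _; rewrite /shifted_pmf subrr mulr0 exprS !mul0r.
rewrite (@ge0_continuous_FTC2y _ _ F a 0).
- by rewrite Fa sub0e EFinN oppeK.
- by move=> x ax; exact: shifted_pmf_ge0.
- exact/continuous_subspaceT/continuous_shifted_pmf.
- rewrite -[X in _ --> X](mulr0 (- theta^-1)); apply: cvgMl_tmp.
  elim: j.+1 => [|i IH]; first by under eq_fun do rewrite big_ord0; exact: cvg_cst.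
  under eq_fun do rewrite big_ord_recr/=.
  have := cvgD IH (cvg_shifted_pmf a i t0); rewrite addr0.
  exact.
- by move=> x _; have [] := dF x.
- apply/cvg_at_right_filter/differentiable_continuous/derivable1_diffP.
  by have [] := dF a.
- by move=> x _; rewrite derive1E; have [_ ->] := dF x.
Qed.

(** * Laws of the counts at one and at two times *)

Lemma measurable_preimage_nat (d : measure_display) (T : measurableType d)
    (f : T -> nat) (B : set nat) :
  measurable_fun setT f -> measurable (f @^-1` B).
Proof. by move=> mf; rewrite -[X in measurable X]setTI; exact: mf. Qed.

Lemma prob_increment_lt (R : realType) (d : measure_display)
    (T : measurableType d) (P : probability T R) (theta : R)
    (N : R -> T -> nat) (hN : poisson_process P theta N) (s t : R) (k : nat) :
  0 < theta -> 0 <= s -> s < t ->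
  P [set w | (N t w - N s w < k)%N] =
    (\sum_(j < k) (shifted_pmf theta s j t)%:E)%E.
Proof.
move=> theta0 s0 st; elim: k => [|k IH].
  rewrite big_ord0 [X in P X](_ : _ = set0) ?measure0//.
  by apply/seteqP; split.
have mD : measurable_fun setT (fun w => N t w - N s w)%N.
  apply: measurable_fun_subn.
    exact: (pp_measurable hN (le_trans s0 (ltW st))).
  exact: (pp_measurable hN s0).
rewrite big_ord_recr/= -IH -shifted_pmfE// -(pp_increment_law hN)//.
rewrite -measureU.
- congr (P _); apply/seteqP; split=> w /=.
    by rewrite ltnS leq_eqVlt => /predU1P[|]; [right|left].
  by move=> [/ltnW|->].
- exact: (measurable_preimage_nat [set i | (i < k)%N] mD).
- exact: (measurable_preimage_nat [set k] mD).
- by apply/seteqP; split=> w //= -[+ ek]; rewrite ek ltnn.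
Qed.

Lemma prob_lt (R : realType) (d : measure_display)
    (T : measurableType d) (P : probability T R) (theta : R)
    (N : R -> T -> nat) (hN : poisson_process P theta N) (t : R) (k : nat) :
  0 < theta -> 0 < t ->
  P [set w | (N t w < k)%N] = (\sum_(j < k) (shifted_pmf theta 0 j t)%:E)%E.
Proof.
move=> theta0 t0; rewrite -(prob_increment_lt hN)//.
by congr (P _); apply/seteqP; split=> w /=; rewrite (pp_start hN) subn0.
Qed.

Lemma prob_eq_increment_lt (R : realType) (d : measure_display)
    (T : measurableType d) (P : probability T R) (theta : R)
    (N : R -> T -> nat) (hN : poisson_process P theta N)
    (t s : R) (j m : nat) : 0 < theta -> 0 < t -> t < s ->
  P [set w | N t w = j /\ (N s w - N t w < m)%N] =
    ((shifted_pmf theta 0 j t)%:E *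
      \sum_(i < m) (shifted_pmf theta t i s)%:E)%E.
Proof.
move=> theta0 t0 ts.
(* The partition 0, t, s, s, ... turns the first two increments into [N t] and [N s - N t], to which
   independence applies. *)
pose u i : R := if i is 0%N then 0 else if i is 1%N then t else s.
have u_mono i : u i <= u i.+1 by move: i => [|[|i]] //=; exact: ltW.
have := pp_independent_increments hN (n := 2) (u := u) (lexx _) u_mono.
pose B (i : 'I_2) := if val i is 0%N then [set j] else [set i | (i < m)%N].
move=> /(_ B (fun i => I)); rewrite !big_ord_recl big_ord0 mule1.
have EP w : (\bigcap_(i in [set: 'I_2])
   (fun w => N (u i.+1) w - N (u i) w)%N @^-1` B i) w <->
    (N t w = j /\ (N s w - N t w < m)%N).
  split=> [h|[h1 h2] [[|[|//]] ?] _]; last 2 first.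
  - by rewrite /B/= (pp_start hN) subn0.
  - exact: h2.
  have := h ord0 I; rewrite /B/= (pp_start hN) subn0 => Nt; split=> //.
  exact: (h ord_max I).
rewrite (_ : \bigcap_(i in _) _ = [set w | N t w = j /\ (N s w - N t w < m)%N]);
  last by apply/seteqP; split=> w /EP.
move=> ->; congr (_ * _)%E.
- rewrite -shifted_pmfE// -(pp_increment_law hN)//.
- by rewrite -(prob_increment_lt hN)// ltW.
Qed.

(** Induction on [k] splits by the value of [N t]: on [N t = j] the condition [N s < n] says that
    the increment is below [n - j], and the increment is independent of [N t]. *)
Lemma prob_lt_lt (R : realType) (d : measure_display)
    (T : measurableType d) (P : probability T R) (theta : R)
    (N : R -> T -> nat) (hN : poisson_process P theta N)
    (t s : R) (k n : nat) : 0 < theta -> 0 < t -> t < s -> (k <= n)%N ->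
  P [set w | (N t w < k)%N /\ (N s w < n)%N] =
    (\sum_(j < k) (shifted_pmf theta 0 j t)%:E *
      \sum_(i < n - j) (shifted_pmf theta t i s)%:E)%E.
Proof.
move=> theta0 t0 ts; elim: k => [_|k IH kn].
  rewrite big_ord0 [X in P X](_ : _ = set0) ?measure0//.
  by apply/seteqP; split=> w // [].
have s0 := lt_trans t0 ts.
have mt := pp_measurable hN (ltW t0); have ms := pp_measurable hN (ltW s0).
rewrite big_ord_recr/= -(IH (ltnW kn)) -(prob_eq_increment_lt hN)//.
rewrite -measureU.
- congr (P _); apply/seteqP; split=> w /=.
    rewrite ltnS leq_eqVlt => -[/predU1P[Nk|Nk] Ns]; [right|by left].
    by split=> //; rewrite Nk ltn_sub2r.
  move=> [[Nk Ns]|[Nk]]; first by split=> //; exact: ltnW.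
  rewrite Nk ltnS; split=> //.
  (* Monotone paths give [k <= N s w], so the truncated subtraction of [k] can be undone on both
     sides of the inequality. *)
  have := pp_nondecreasing hN w (ltW t0) (ltW ts); rewrite Nk => kNs.
  by rewrite -(ltn_sub2rE _ kNs).
- apply: measurableI.
    exact: (measurable_preimage_nat [set i | (i < k)%N] mt).
  exact: (measurable_preimage_nat [set i | (i < n)%N] ms).
- apply: measurableI; first exact: (measurable_preimage_nat [set k] mt).
  apply: (measurable_preimage_nat [set i | (i < n - k)%N]
    (measurable_fun_subn ms mt)).
- by apply/seteqP; split=> w //= -[[+ _] [ek _]]; rewrite ek ltnn.
Qed.

(** * The region before the k-th arrival *)

(** A set in the product space, so that Tonelli can read it both ways: its sections at [w] have the
    arrival times as lengths, its sections at [t > 0] are the events [N t < k]. *)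
Definition survival_set (R : realType) (T : Type) (N : R -> T -> nat) (k : nat) :
  set (T * R) := [set z | 0 < z.2 /\ (N z.2 z.1 < k)%N].

(** By monotonicity and right-continuity, [N t < k] holds exactly when [N q < k] for some rational
    [q > t], so the region is a countable union of rectangles. *)
Lemma measurable_survival_set (R : realType) (d : measure_display)
    (T : measurableType d) (P : probability T R) (theta : R)
    (N : R -> T -> nat) (hN : poisson_process P theta N) (k : nat) :
  measurable (survival_set N k).
Proof.
rewrite (_ : survival_set N k = \bigcup_(q : rat)
    ([set w | 0 < ratr q :> R /\ (N (ratr q) w < k)%N] `*` `]0, ratr q[)).
  apply: bigcupT_measurable_rat => q; apply: measurableX => //.
  have [q0|q0] := ltP (0 : R) (ratr q); last first.
    by rewrite (_ : [set w | _] = set0)//; apply/seteqP; split=> w // [].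
  rewrite (_ : [set w | _] = N (ratr q) @^-1` [set i | (i < k)%N]).
    exact: measurable_preimage_nat (pp_measurable hN (ltW q0)).
  by apply/seteqP; split=> w //= [].
apply/seteqP; split=> [[w t] /= [t0 Ntk]|[w t] /= [q _ [/= [q0 Nq]]]]; last first.
  rewrite in_itv/= => /andP[t0 tq]; split=> //.
  by apply: leq_ltn_trans Nq; exact: (pp_nondecreasing hN w (ltW t0) (ltW tq)).
(* Singletons of [nat] are open, so right-continuity means constancy just after [t], which leaves
   room for a rational. *)
have rc : \forall s \near t^'+, N s w = N t w.
  exact: (pp_right_continuous hN (ltW t0) (discrete_set1 (N t w))).
near t^'+ => s.
have ts : t < s by near: s; exact: nbhs_right_gt.
have Ns : N s w = N t w by near: s.
have [q] := rat_in_itvoo ts; rewrite in_itv/= => /andP[tq qs].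
exists q => //=; split; last by rewrite in_itv/= t0.
split; first exact: lt_trans t0 tq.
apply: leq_ltn_trans Ntk; rewrite -Ns.
exact: (pp_nondecreasing hN w (ltW (lt_trans t0 tq)) (ltW qs)).
Unshelve. all: by end_near. Qed.

(** * Passage time and area along one path *)

(** The witness is the ceiling of [x], cut off at 0. Stated as an equivalence for every [j], it also
    covers [x <= 0] and passes to [x - 1] by shifting [j]. *)
Lemma exists_level (R : realType) (x : R) :
  exists m : nat, forall j : nat, (x <= j%:R) = (m <= j)%N.
Proof.
have ex : exists j : nat, x <= j%:R.
  exists (Num.bound `|x|); apply: ltW.
  exact: le_lt_trans (ler_norm _) (archi_boundP (normr_ge0 x)).
exists (ex_minn ex) => j; case: ex_minnP => m xm minm.
apply/idP/idP => [/minm//|mj]; apply: le_trans xm _.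
by rewrite ler_nat.
Qed.

(** The hypotheses squeeze [E] between []0, r[] and []0, r]], which have equal length; whether [r]
    itself belongs to [E] is left open. *)
Lemma measure_initial_segment (R : realType) (r : \bar R) (E : set R) :
  measurable E -> (0 <= r)%E ->
  (forall t, 0 < t -> (t%:E < r)%E -> E t) ->
  (forall t, E t -> 0 < t /\ (t%:E <= r)%E) ->
  lebesgue_measure E = r.
Proof.
move=> mE; case: r => [r| |] r0 subE Esub //.
- apply/eqP; rewrite eq_le; apply/andP; split.
    apply: (@le_trans _ _ (lebesgue_measure `]0, r])).
      apply: le_measure; rewrite ?inE//.
      by move=> t /Esub[t0 tr]; rewrite /= in_itv/= t0.
    rewrite lebesgue_measure_itv/= lte_fin.
    by case: ifPn; rewrite ?oppr0 ?adde0 ?sube0.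
  apply: (@le_trans _ _ (lebesgue_measure `]0, r[)).
    rewrite lebesgue_measure_itv/= lte_fin.
    by case: ifPn; rewrite ?oppr0 ?adde0 ?sube0// -leNgt.
  apply: le_measure; rewrite ?inE//.
  by move=> t /=; rewrite in_itv/= => /andP[t0 tr]; exact: subE.
- rewrite (_ : E = `]0, +oo[%classic); first by rewrite lebesgue_measure_itv/= ltry.
  apply/seteqP; split=> t; first by move=> /Esub[t0 _]; rewrite /= in_itv/= t0.
  by rewrite /= in_itv/= andbT => t0; apply: subE => //; exact: ltry.
Qed.

(** The integration set and [E] differ at most in the endpoints 0 and [r], a null set. On the open
    interval [f] equals [g] and inherits its measurability; as [g] vanishes off [E], the integral
    extends to the whole line. *)
Lemma integral_initial_segment (R : realType) (r : \bar R) (E : set R)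
    (f g : R -> R) : (0 <= r)%E ->
  (forall t, 0 < t -> (t%:E < r)%E -> E t) ->
  (forall t, E t -> 0 < t /\ (t%:E <= r)%E) ->
  measurable_fun setT g -> (forall t, E t -> f t = g t) ->
  (forall t, ~ E t -> g t = 0) ->
  (\int[lebesgue_measure]_(t in [set t | (0 <= t)%R /\ (t%:E <= r)%E]) (f t)%:E
   = \int[lebesgue_measure]_t (g t)%:E)%E.
Proof.
move=> r0 subE Esub mg fg g0.
have mg' D : measurable_fun D (EFin \o g).
  by apply/measurable_EFinP; exact: measurable_funTS.
case: r r0 subE Esub => [r| |] r0 subE Esub //.
- rewrite (_ : [set t | _] = `[0, r]%classic); last first.
    by apply/seteqP; split=> t; rewrite /= in_itv/= lee_fin => /andP.
  have fgr : {in `]0, r[%classic, (EFin \o f) =1 (EFin \o g)}.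
    move=> t; rewrite inE/= in_itv/= => /andP[t0 tr]; rewrite fg//.
    exact: subE.
  rewrite (@integral_itv_bndoo _ _ _ (EFin \o f))//; last first.
    apply: eq_measurable_fun (mg' _) => t tr; apply/esym; exact: fgr.
  transitivity (\int[lebesgue_measure]_(t in `]0%R, r[) (EFin \o g) t)%E.
    exact: eq_integral.
  rewrite -(@integral_itv_bndoo _ _ _ _ false false)//.
  rewrite integral_mkcond; apply: eq_integral => t _.
  rewrite patchE; case: ifPn => // /negP tr; rewrite g0// => /Esub[t0 tler].
  by apply: tr; rewrite inE/= in_itv/= t0.
- rewrite (_ : [set t | _] = `[0, +oo[%classic); last first.
    apply/seteqP; split=> t; rewrite /= in_itv/= andbT; first by case.
    by move=> t0; split=> //; exact: leey.
  have Et t : (`]0, +oo[%classic t) -> E t.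
    by rewrite /= in_itv/= andbT => t0; apply: subE => //; exact: ltry.
  have fgr : {in `]0, +oo[%classic, (EFin \o f) =1 (EFin \o g)}.
    by move=> t; rewrite inE/= => /Et Et'; rewrite /= fg.
  rewrite -integral_itv_obnd_cbnd//; last first.
    apply: eq_measurable_fun (mg' _) => t tr; apply/esym; exact: fgr.
  transitivity (\int[lebesgue_measure]_(t in `]0%R, +oo[) (EFin \o g) t)%E.
    exact: eq_integral.
  rewrite integral_mkcond; apply: eq_integral => t _.
  rewrite patchE; case: ifPn => // /negP tr; rewrite g0// => /Esub[t0 _].
  by apply: tr; rewrite inE/= in_itv/= t0.
Qed.

Lemma xsection_survival_set (R : realType) (T : Type) (N : R -> T -> nat)
    (k : nat) (w : T) :
  xsection (survival_set N k) w = [set t | 0 < t /\ (N t w < k)%N].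
Proof. by apply/seteqP; split=> t; rewrite /xsection /survival_set /= inE. Qed.

(** As the length of a section it is open to Tonelli's theorem; it is [+oo] on a path that never
    reaches [k]. *)
Definition arrival_time (R : realType) (T : Type) (N : R -> T -> nat)
  (k : nat) (w : T) : \bar R :=
  lebesgue_measure (xsection (survival_set N k) w : set R).

Lemma tau_ge0 (R : realType) (d : measure_display) (T : measurableType d)
    (N : R -> T -> nat) (x : R) (w : T) : (0 <= tau N x w)%E.
Proof.
rewrite /tau; case: ifPn => // _; apply: le_ereal_inf_tmp => _ [t [t0 _] <-].
by rewrite lee_fin ltW.
Qed.

(** With [le_tau] this squeezes the times with [N t < m] between []0, tau[] and []0, tau]], as the
    initial-segment lemmas require. *)
Lemma lt_tau (R : realType) (d : measure_display) (T : measurableType d)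
    (N : R -> T -> nat) (x : R) (m : nat) (t : R) (w : T) :
  (forall j : nat, (x <= j%:R) = (m <= j)%N) ->
  0 < t -> (t%:E < tau N x w)%E -> (N t w < m)%N.
Proof.
move=> mx t0; rewrite /tau; case: ifPn => [_|_ tlt].
  by rewrite lte_fin ltNge ltW.
rewrite ltnNge -mx; apply/negP => xN.
move: tlt; rewrite ltNge => /negP; apply; apply: ereal_inf_lbound.
by exists t => //; split=> //; rewrite /proc subr_le0.
Qed.

Lemma le_tau (R : realType) (d : measure_display) (T : measurableType d)
    (P : probability T R) (theta : R)
    (N : R -> T -> nat) (hN : poisson_process P theta N)
    (x : R) (m : nat) (t : R) (w : T) :
  (forall j : nat, (x <= j%:R) = (m <= j)%N) ->
  0 < t -> (N t w < m)%N -> (t%:E <= tau N x w)%E.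
Proof.
move=> mx t0 Ntm; rewrite /tau; case: ifPn => [x0|_].
  by have := mx 0%N; rewrite x0 leqn0 => /esym/eqP m0; rewrite m0 in Ntm.
apply: le_ereal_inf_tmp => _ [s [s0 +] <-]; rewrite /proc subr_le0 mx => mNs.
rewrite lee_fin leNgt; apply/negP => st.
have := pp_nondecreasing hN w (ltW s0) (ltW st) => /(leq_trans mNs).
by rewrite leqNgt Ntm.
Qed.

Lemma measurable_survival_section (R : realType) (d : measure_display)
    (T : measurableType d) (P : probability T R) (theta : R)
    (N : R -> T -> nat) (hN : poisson_process P theta N) (k : nat) (w : T) :
  measurable ([set t | 0 < t /\ (N t w < k)%N] : set R).
Proof.
rewrite -xsection_survival_set; apply: measurable_xsection.
exact: measurable_survival_set hN k.
Qed.

Lemma tauE (R : realType) (d : measure_display) (T : measurableType d)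
    (P : probability T R) (theta : R)
    (N : R -> T -> nat) (hN : poisson_process P theta N)
    (x : R) (m : nat) (w : T) :
  (forall j : nat, (x <= j%:R) = (m <= j)%N) ->
  tau N x w = arrival_time N m w.
Proof.
move=> mx; rewrite /arrival_time xsection_survival_set.
apply/esym/measure_initial_segment.
- exact: measurable_survival_section hN m w.
- exact: tau_ge0.
- by move=> t t0 tt; split=> //; exact: lt_tau tt.
- by move=> t [t0 Nt]; split=> //; exact: (le_tau hN mx).
Qed.

Lemma sum_leq_ord (n j : nat) : (\sum_(i < n) (j <= i)%N)%N = (n - j)%N.
Proof.
elim: n => [|n IH]; first by rewrite big_ord0 sub0n.
rewrite big_ord_recr/= IH; case: leqP => [jn|nj]; first by rewrite addn1 subSn.
move: (nj) (ltnW nj); rewrite -!subn_eq0 => /eqP -> /eqP ->.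
by rewrite addn0.
Qed.

(** A layer-cake decomposition: before passage [x - N t = (x - n) + (n - N t)], and [n - N t] counts
    the levels [i < n] with [N t < i + 1]; integrating each indicator gives an arrival time. *)
Lemma areaE (R : realType) (d : measure_display) (T : measurableType d)
    (P : probability T R) (theta : R)
    (N : R -> T -> nat) (hN : poisson_process P theta N)
    (x : R) (n : nat) (w : T) :
  (forall j : nat, (x <= j%:R) = (n.+1 <= j)%N) ->
  area N x w = ((x - n%:R)%:E * arrival_time N n.+1 w +
                \sum_(i < n) arrival_time N i.+1 w)%E.
Proof.
move=> mx; rewrite /area (mx 0%N : (x <= 0) = _).
pose E k : set R := [set t | 0 < t /\ (N t w < k)%N].
have mE k : measurable (E k) by exact: measurable_survival_section hN k w.
have IE k : (\int[lebesgue_measure]_t (\1_(E k) t)%:E = arrival_time N k w)%E.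
  rewrite integral_indic; [|exact: measurableT|exact: mE].
  by rewrite setIT /arrival_time xsection_survival_set.
have xn : 0 <= x - n%:R.
  by rewrite subr_ge0 ltW// ltNge mx ltnn.
pose g (t : R) : R := (x - n%:R) * \1_(E n.+1) t + \sum_(i < n) \1_(E i.+1) t.
have mg1 : measurable_fun setT (fun t : R => (x - n%:R) * \1_(E n.+1) t).
  exact: measurable_funM.
have mg2 : measurable_fun setT (fun t : R => \sum_(i < n) (\1_(E i.+1) t : R)).
  by apply: measurable_sum => i; exact: measurable_indic.
rewrite (@integral_initial_segment _ _ (E n.+1) _ g).
- under eq_integral do rewrite /g EFinD EFinM -sumEFin.
  rewrite ge0_integralD//=; last 4 first.
  - by move=> t _; rewrite -EFinM lee_fin mulr_ge0.
  - by under eq_fun do rewrite -EFinM; exact/measurable_EFinP.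
  - by move=> t _; apply: sume_ge0 => i _; rewrite lee_fin.
  - by under eq_fun do rewrite sumEFin; exact/measurable_EFinP.
  rewrite ge0_integralZl_EFin//=; last first.
    by apply/measurable_EFinP; exact: (measurable_indic (mE _)).
  rewrite IE; congr (_ + _)%E; rewrite ge0_integral_sum//=; last first.
    by move=> i; apply/measurable_EFinP; exact: (measurable_indic (mE _)).
  by apply: eq_bigr => i _; exact: IE.
- exact: tau_ge0.
- by move=> t t0 tt; split=> //; exact: lt_tau tt.
- by move=> t [t0 Nt]; split=> //; exact: (le_tau hN mx).
- exact: measurable_funD.
- move=> t Et; have [t0 Ntn] := Et.
  rewrite /g /proc indicE mem_set// mulr1.
  have -> : \sum_(i < n) (\1_(E i.+1) t : R) = (n - N t w)%N%:R.
    rewrite (eq_bigr (fun i : 'I_n => (N t w <= i)%N%:R)); last first.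
      move=> i _; rewrite indicE; congr (nat_of_bool _)%:R.
      by apply/idP/idP => [|h]; [rewrite inE => -[]|rewrite inE].
    rewrite -natr_sum; congr (_ %:R).
    exact: sum_leq_ord.
  by rewrite natrB//; ring.
(* The sets [E k] grow with [k], so all indicators vanish outside [E n.+1]. *)
- move=> t nEt; rewrite /g indicE memNset// mulr0 add0r big1// => i _.
  rewrite indicE memNset// => -[t0 Nti]; apply: nEt; split=> //.
  by apply: leq_trans Nti _; rewrite ltnS ltnW.
Qed.

(** * First and second moments of the arrival times *)

(** The index map [e] is left free because the second moment uses weights of index [j.+1] besides
    those of index [j]. *)
Lemma integral_sum_shifted_pmf (R : realType) (theta a : R) (m : nat)
    (c : nat -> R) (e : nat -> nat) : 0 < theta -> (forall i, 0 <= c i) ->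
  (\int[lebesgue_measure]_(s in `]a, +oo[)
     (\sum_(i < m) (c i * shifted_pmf theta a (e i) s)%:E)
   = (\sum_(i < m) c i / theta)%:E)%E.
Proof.
move=> t0 c0.
have pmf0 i s : `]a, +oo[%classic s -> (0 <= (shifted_pmf theta a i s)%:E)%E.
  rewrite /= in_itv/= andbT => as_; rewrite lee_fin.
  by apply: shifted_pmf_ge0 => //; exact: ltW.
rewrite ge0_integral_sum//; last 2 first.
- move=> i; apply/measurable_EFinP; apply: measurable_funM => //.
  exact: measurable_shifted_pmf.
- by move=> i s /pmf0 h; rewrite EFinM mule_ge0// lee_fin.
rewrite -sumEFin; apply: eq_bigr => i _.
under eq_integral do rewrite EFinM.
rewrite ge0_integralZl_EFin//; last first.
- by apply/measurable_EFinP; exact: measurable_shifted_pmf.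
- exact: pmf0.
by rewrite integral_shifted_pmf// EFinM.
Qed.

Lemma arrival_time_ge0 (R : realType) (T : Type) (N : R -> T -> nat) (k : nat)
  (w : T) : (0 <= arrival_time N k w)%E.
Proof. exact: measure_ge0. Qed.

Lemma measurable_arrival_time (R : realType) (d : measure_display)
    (T : measurableType d) (P : probability T R) (theta : R)
    (N : R -> T -> nat) (hN : poisson_process P theta N) (k : nat) :
  measurable_fun setT (arrival_time N k).
Proof.
exact: (measurable_fun_xsection lebesgue_measure
  (measurable_survival_set hN k)).
Qed.

Lemma measurable_lt_event (R : realType) (d : measure_display)
    (T : measurableType d) (P : probability T R) (theta : R)
    (N : R -> T -> nat) (hN : poisson_process P theta N) (t : R) (k : nat) :
  0 <= t -> measurable [set w | (N t w < k)%N].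
Proof.
move=> t0; exact: (measurable_preimage_nat [set i | (i < k)%N]
  (pp_measurable hN t0)).
Qed.

(** The arrival time is the integral of an indicator over [t], so Tonelli applies to any measurable
    [h >= 0]. With [h] general it serves for the means and, used twice, for the products. *)
Lemma integral_arrival_time_mul (R : realType) (d : measure_display)
    (T : measurableType d) (P : probability T R) (theta : R)
    (N : R -> T -> nat) (hN : poisson_process P theta N) (k : nat)
    (h : T -> \bar R) : measurable_fun setT h -> (forall w, 0 <= h w)%E ->
  (\int[P]_w (arrival_time N k w * h w)
   = \int[lebesgue_measure]_(t in `]0%R, +oo[)
       \int[P]_(w in [set w | (N t w < k)%N]) h w)%E.
Proof.
move=> mh h0; pose A : set (T * R) := survival_set N k.
have mA : measurable A by exact: measurable_survival_set hN k.
pose f (z : T * R) : \bar R := ((\1_A z)%:E * h z.1)%E.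
have mf : measurable_fun setT f.
  apply: emeasurable_funM; first exact/measurable_EFinP/measurable_indic.
  exact: measurableT_comp.
have f0 z : (0 <= f z)%E by rewrite mule_ge0// lee_fin.
transitivity (\int[P]_w \int[lebesgue_measure]_t f (w, t))%E.
  apply: eq_integral => w _; rewrite /f/=.
  rewrite ge0_integralZr//=; last first.
    apply/measurable_EFinP; apply: (measurableT_comp (measurable_indic mA)).
    exact: measurable_pair1.
  congr (_ * _)%E.
  have mx : measurable (xsection A w) by exact: measurable_xsection.
  rewrite /arrival_time -/A -[RHS](_ : \int[lebesgue_measure]_t (\1_(xsection A w) t)%:E = _)%E.
    by rewrite integral_indic// setIT.
  by apply: eq_integral => t _; rewrite !indicE mem_xsection.
rewrite (@fubini_tonelli _ _ _ _ _ P lebesgue_measure f)//.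
rewrite [RHS]integral_mkcond; apply: eq_integral => t _.
rewrite patchE; case: ifPn => [|] tpos.
  rewrite [RHS]integral_mkcond; apply: eq_integral => w _.
  move: tpos; rewrite inE/= in_itv/= andbT => tpos.
  have -> : f (w, t) = ((w \in [set w | (N t w < k)%N])%:R%:E * h w)%E.
    rewrite /f indicE; congr ((nat_of_bool _)%:R%:E * _)%E.
    by apply/idP/idP; rewrite !inE; [case|split].
  by rewrite patchE; case: ifPn; rewrite ?mul1e ?mul0e.
(* For [t <= 0] the region has an empty section. *)
rewrite integral0_eq// => w _; rewrite /f indicE memNset ?mul0e// => -[/= t0 _].
by move/negP: tpos; apply; rewrite inE/= in_itv/= t0.
Qed.

(** Tonelli with [h = 1] leaves the probability of [N t < k], a sum of [k] weights, each of integral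
    [theta^-1]. *)
Lemma expectation_arrival_time (R : realType) (d : measure_display)
    (T : measurableType d) (P : probability T R) (theta : R)
    (N : R -> T -> nat) (hN : poisson_process P theta N) (k : nat) :
  0 < theta -> (\int[P]_w arrival_time N k w = (k%:R / theta)%:E)%E.
Proof.
move=> theta0.
transitivity (\int[P]_w (arrival_time N k w * cst 1%E w))%E.
  by apply: eq_integral => w _; rewrite mule1.
rewrite (integral_arrival_time_mul hN)//.
transitivity (\int[lebesgue_measure]_(t in `]0%R, +oo[)
    (\sum_(j < k) (1 * shifted_pmf theta 0 j t)%:E))%E.
  apply: eq_integral => t; rewrite inE/= in_itv/= andbT => t0.
  rewrite integral_cst ?mul1e; last exact: measurable_lt_event hN _ _ (ltW t0).
  apply: eq_trans (prob_lt hN k theta0 t0) _.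
  by apply: eq_bigr => j _; rewrite mul1r.
apply: eq_trans
  (@integral_sum_shifted_pmf _ _ 0 k (fun=> 1) id theta0 _) _ => //.
by rewrite -mulr_suml sumr_const card_ord.
Qed.

(** The left side is the mean of the [n]-th arrival time on [N t < k]. Up to time [t] the event
    [N s < n] is automatic there; after [t], given [N t = j], the [n - j] arrivals still missing
    take mean time [(n - j) / theta]. *)
Lemma integral_prob_lt_lt (R : realType) (d : measure_display)
    (T : measurableType d) (P : probability T R) (theta : R)
    (N : R -> T -> nat) (hN : poisson_process P theta N) (k n : nat) (t : R) :
  0 < theta -> (k <= n)%N -> 0 < t ->
  (\int[lebesgue_measure]_(s in `]0%R, +oo[)
     P ([set w | (N t w < k)%N] `&` [set w | (N s w < n)%N])
   = \sum_(j < k) (shifted_pmf theta 0 j t * (t + (n - j)%:R / theta))%:E)%E.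
Proof.
move=> theta0 kn t0.
pose f s := P ([set w | (N t w < k)%N] `&` [set w | (N s w < n)%N]).
have f1 : {in `]0, t]%classic, f =1 cst (P [set w | (N t w < k)%N])}.
  move=> s; rewrite inE/= in_itv/= => /andP[s0 st]; rewrite /f setIidl//.
  move=> w /= Nt; apply: leq_trans kn; apply: leq_ltn_trans Nt.
  exact: (pp_nondecreasing hN w (ltW s0) st).
pose g s : \bar R := (\sum_(j < k) (shifted_pmf theta 0 j t)%:E *
  \sum_(i < n - j) (1 * shifted_pmf theta t i s)%:E)%E.
have f2 : {in `]t, +oo[%classic, f =1 g}.
  move=> s; rewrite inE/= in_itv/= andbT => ts; rewrite /f.
  rewrite -[X in P X]/[set w | (N t w < k)%N /\ (N s w < n)%N].
  rewrite (prob_lt_lt hN)//; apply: eq_bigr => j _; congr (_ * _)%E.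
  by apply: eq_bigr => i _; rewrite mul1r.
have msum j : measurable_fun (`]t, +oo[ : set R) (fun s => (\sum_(i < n - j)
    (1 * shifted_pmf theta t i s)%:E)%E).
  apply: emeasurable_sum => i; apply/measurable_EFinP.
  by apply: measurable_funM => //; exact: measurable_shifted_pmf.
have pmf0 j : 0 <= shifted_pmf theta 0 j t.
  by apply: shifted_pmf_ge0 => //; exact: ltW.
have sum0 j s : (`]t, +oo[%classic s) -> (0 <= \sum_(i < n - j)
    (1 * shifted_pmf theta t i s)%:E)%E.
  rewrite /= in_itv/= andbT => ts; apply: sume_ge0 => i _.
  by rewrite mul1r lee_fin; apply: shifted_pmf_ge0 => //; exact: ltW.
have E : `]0, +oo[%classic = `]0, t] `|` `]t, +oo[ :> set R.
  by rewrite -itv_bndbnd_setU// bnd_simp// ltW.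
have mf1 : measurable_fun (`]0, t] : set R) f.
  apply: (eq_measurable_fun (cst (P [set w | (N t w < k)%N]))) => // s /f1.
  exact: esym.
have mf2 : measurable_fun (`]t, +oo[ : set R) f.
  apply: (eq_measurable_fun g) => [s /f2/esym//|].
  by apply: emeasurable_sum => j; exact: measurable_funeM.
have I1 : (\int[lebesgue_measure]_(s in `]0%R, t]) f s
    = (\sum_(j < k) shifted_pmf theta 0 j t * t)%:E)%E.
  transitivity (\int[lebesgue_measure]_(s in `]0%R, t])
      cst (P [set w | (N t w < k)%N]) s)%E; first exact: eq_integral.
  rewrite integral_cst//= lebesgue_measure_itv/= lte_fin t0 oppr0 adde0.
  by rewrite (prob_lt hN)// sumEFin -EFinM mulr_suml.
have I2 : (\int[lebesgue_measure]_(s in `]t, +oo[) f s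
    = (\sum_(j < k) shifted_pmf theta 0 j t * ((n - j)%:R / theta))%:E)%E.
  transitivity (\int[lebesgue_measure]_(s in `]t, +oo[) g s)%E.
    exact: eq_integral.
  rewrite ge0_integral_sum//=; last 2 first.
  - by move=> j; exact: (measurable_funeM _ (msum j)).
  - by move=> j s ts; apply: mule_ge0; [rewrite lee_fin|exact: sum0].
  rewrite -sumEFin; apply: eq_bigr => j _.
  rewrite ge0_integralZl_EFin//; last first.
  - exact: msum.
  - exact: sum0.
  rewrite (@integral_sum_shifted_pmf _ _ t (n - j) (fun=> 1) id theta0)//.
  by rewrite -EFinM -mulr_suml sumr_const card_ord.
transitivity (\int[lebesgue_measure]_(s in `]0%R, t] `|` `]t, +oo[) f s)%E.
  by rewrite -E.
rewrite ge0_integral_setU//; last 2 first.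
- exact/measurable_funU.
- apply/disj_setPRL => s /=; rewrite !in_itv/= andbT => ts.
  by apply/negP; rewrite negb_and -!ltNge ts orbT.
apply: eq_trans (congr2 (fun a b : \bar R => a + b)%E I1 I2) _ => /=.
rewrite -EFinD -big_split/= sumEFin; congr EFin.
by apply: eq_bigr => j _; rewrite mulrDr.
Qed.

(** Writing [p_j] for the weights, [t * p_j(t) = (j+1) / theta * p_(j+1)(t)]. Hence the [j]-th
    summand integrates to [((j+1) + (n-j)) / theta^2], which does not depend on [j], and there are
    [k] summands. *)
Lemma expectation_arrival_time_mul (R : realType) (d : measure_display)
    (T : measurableType d) (P : probability T R) (theta : R)
    (N : R -> T -> nat) (hN : poisson_process P theta N) (k n : nat) :
  0 < theta -> (k <= n)%N ->
  (\int[P]_w (arrival_time N n w * arrival_time N k w)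
   = ((k * n.+1)%:R / theta ^+ 2)%:E)%E.
Proof.
move=> theta0 kn.
have mT := measurable_arrival_time hN.
(* The smaller index is attached to the outer time, as [integral_prob_lt_lt] requires. *)
transitivity (\int[P]_w (arrival_time N k w * arrival_time N n w))%E.
  by apply: eq_integral => w _; rewrite muleC.
rewrite (integral_arrival_time_mul hN)//.
transitivity (\int[lebesgue_measure]_(t in `]0%R, +oo[)
    (\sum_(j < k) (((j.+1)%:R / theta) * shifted_pmf theta 0 j.+1 t)%:E +
     \sum_(j < k) (((n - j)%:R / theta) * shifted_pmf theta 0 j t)%:E))%E.
  apply: eq_integral => t; rewrite inE/= in_itv/= andbT => t0.
  have mB := measurable_lt_event hN k (ltW t0).
  (* The restriction to [N t < k] becomes a factor, so that Tonelli applies a second time with this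
     indicator as [h]. *)
  transitivity (\int[P]_w (arrival_time N n w *
      (\1_[set w | (N t w < k)%N] w)%:E))%E.
    rewrite integral_mkcond; apply: eq_integral => w _.
    by rewrite patchE indicE; case: ifPn; rewrite ?mule1 ?mule0.
  rewrite (integral_arrival_time_mul hN)//; last first.
    by apply/measurable_EFinP; exact: measurable_indic.
  transitivity (\int[lebesgue_measure]_(s in `]0%R, +oo[)
     P ([set w | (N t w < k)%N] `&` [set w | (N s w < n)%N]))%E.
    apply: eq_integral => s; rewrite inE/= in_itv/= andbT => s0.
    by rewrite integral_indic//; exact: measurable_lt_event hN _ _ (ltW s0).
  rewrite (integral_prob_lt_lt hN)// -big_split/=; apply: eq_bigr => j _.
  rewrite -EFinD; congr EFin.
  rewrite /shifted_pmf subr0 factS natrM exprS.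
  have : j.+1%:R != 0 :> R by rewrite pnatr_eq0.
  have : j`!%:R != 0 :> R by rewrite pnatr_eq0 -lt0n fact_gt0.
  have : theta != 0 by rewrite gt_eqF.
  by move: j.+1%:R j`!%:R (n - j)%:R => x y z th0 y0 x0; field; rewrite th0 y0.
have c0 m : 0 <= m%:R / theta by rewrite divr_ge0// ltW.
have mterm c i :
    measurable_fun (`]0, +oo[ : set R) (fun t => (c * shifted_pmf theta 0 i t)%:E).
  apply/measurable_EFinP; apply: measurable_funM => //.
  exact: measurable_shifted_pmf.
have pmf0 i t : (`]0, +oo[%classic t) -> 0 <= shifted_pmf theta 0 i t.
  by rewrite /= in_itv/= andbT => t0; apply: shifted_pmf_ge0 => //; exact: ltW.
rewrite ge0_integralD//=; last 4 first.
- by move=> t /pmf0 h; apply: sume_ge0 => i _; rewrite lee_fin mulr_ge0.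
- by apply: emeasurable_sum => i; exact: mterm.
- by move=> t /pmf0 h; apply: sume_ge0 => i _; rewrite lee_fin mulr_ge0.
- by apply: emeasurable_sum => i; exact: mterm.
rewrite (@integral_sum_shifted_pmf _ _ 0 k (fun j => j.+1%:R / theta) S)//.
rewrite (@integral_sum_shifted_pmf _ _ 0 k (fun j => (n - j)%:R / theta) id)//.
rewrite -EFinD -big_split/=; congr EFin.
rewrite (eq_bigr (fun=> n.+1%:R / theta ^+ 2)); last first.
  move=> j _; rewrite -!mulrDl -natrD -mulrA -invfM -expr2.
  by rewrite addSn subnKC// ltnW// (leq_trans (ltn_ord j)).
by rewrite sumr_const card_ord natrM -[LHS]mulr_natl mulrA.
Qed.

(** * Closed forms for the expectations *)

(** This is [theta] times the mean area at level [m]. At [m = 0] the truncated [m.-1] is harmless: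
    the factor [m%:R] is 0 and the sum is empty. *)
Definition area_weight (R : realType) (m : nat) (x : R) : R :=
  (x - m.-1%:R) * m%:R + \sum_(i < m.-1) i.+1%:R.

(** First-jump decomposition in mean form: the process spends mean time [1 / theta] at height [x],
    then starts afresh from [x - 1]. *)
Lemma area_weightS (R : realType) (m : nat) (x : R) :
  area_weight m.+1 x = area_weight m (x - 1) + x.
Proof.
rewrite /area_weight; case: m => [|m]/=; first by rewrite !big_ord0; ring.
by rewrite big_ord_recr/= -(natr1 m.+1) -(natr1 m); ring.
Qed.

Lemma area_nonpos (R : realType) (d : measure_display) (T : measurableType d)
    (N : R -> T -> nat) (x : R) (w : T) : x <= 0 -> area N x w = 0%E.
Proof. by move=> x0; rewrite /area x0. Qed.

Lemma tau_nonpos (R : realType) (d : measure_display) (T : measurableType d)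
    (N : R -> T -> nat) (x : R) (w : T) : x <= 0 -> tau N x w = 0%E.
Proof. by move=> x0; rewrite /tau x0. Qed.

Lemma level0_nonpos (R : realType) (x : R) :
  (forall j : nat, (x <= j%:R) = (0 <= j)%N) -> x <= 0.
Proof. by move=> /(_ 0%N) ->. Qed.

Lemma measurable_tau (R : realType) (d : measure_display)
    (T : measurableType d) (P : probability T R) (theta : R)
    (N : R -> T -> nat) (hN : poisson_process P theta N) (x : R) :
  measurable_fun setT (tau N x).
Proof.
have [m mx] := exists_level x.
rewrite (_ : tau N x = arrival_time N m); last first.
  by apply/funext => w; rewrite (tauE hN w mx).
exact: measurable_arrival_time hN m.
Qed.

Lemma measurable_area (R : realType) (d : measure_display)
    (T : measurableType d) (P : probability T R) (theta : R)
    (N : R -> T -> nat) (hN : poisson_process P theta N) (x : R) :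
  measurable_fun setT (area N x).
Proof.
have [[|n] mx] := exists_level x.
  rewrite (_ : area N x = cst 0%E)//; apply/funext => w.
  by rewrite area_nonpos//; exact: level0_nonpos.
rewrite (_ : area N x = fun w => ((x - n%:R)%:E * arrival_time N n.+1 w +
    \sum_(i < n) arrival_time N i.+1 w)%E); last first.
  by apply/funext => w; rewrite (areaE hN w mx).
have mT := measurable_arrival_time hN.
apply: emeasurable_funD; first exact: measurable_funeM.
by apply: emeasurable_sum.
Qed.

Lemma area_ge0 (R : realType) (d : measure_display)
    (T : measurableType d) (P : probability T R) (theta : R)
    (N : R -> T -> nat) (hN : poisson_process P theta N) (x : R) (w : T) :
  (0 <= area N x w)%E.
Proof.
have [[|n] mx] := exists_level x.
  by rewrite area_nonpos//; exact: level0_nonpos.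
rewrite (areaE hN w mx); apply: adde_ge0.
  rewrite mule_ge0 ?arrival_time_ge0// lee_fin subr_ge0 ltW//.
  by rewrite ltNge mx ltnn.
by apply: sume_ge0 => i _; exact: arrival_time_ge0.
Qed.

(** The factor [h] is general: the constant 1 gives the mean area, [tau N x] gives [V]. *)
Lemma integral_mul_area (R : realType) (d : measure_display)
    (T : measurableType d) (P : probability T R) (theta : R)
    (N : R -> T -> nat) (hN : poisson_process P theta N) (x : R) (n : nat)
    (h : T -> \bar R) :
  (forall j : nat, (x <= j%:R) = (n.+1 <= j)%N) ->
  measurable_fun setT h -> (forall w, 0 <= h w)%E ->
  (\int[P]_w (h w * area N x w)
   = (x - n%:R)%:E * (\int[P]_w (h w * arrival_time N n.+1 w)) +
     \sum_(i < n) \int[P]_w (h w * arrival_time N i.+1 w))%E.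
Proof.
move=> mx mh h0.
have mhT i : measurable_fun setT (fun w => (h w * arrival_time N i w)%E).
  by apply: emeasurable_funM => //; exact: measurable_arrival_time hN i.
have hT0 i w : (0 <= h w * arrival_time N i w)%E.
  by rewrite mule_ge0// arrival_time_ge0.
have xn : 0 <= x - n%:R by rewrite subr_ge0 ltW// ltNge mx ltnn.
transitivity (\int[P]_w ((x - n%:R)%:E * (h w * arrival_time N n.+1 w) +
    \sum_(i < n) (h w * arrival_time N i.+1 w)))%E.
  apply: eq_integral => w _; rewrite (areaE hN w mx) ge0_muleDr; last 2 first.
  - by rewrite mule_ge0// arrival_time_ge0.
  - by apply: sume_ge0 => i _; exact: arrival_time_ge0.
  rewrite muleCA ge0_sume_distrr// => i _; exact: arrival_time_ge0.
rewrite ge0_integralD//; last 4 first.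
- by move=> w _; rewrite mule_ge0.
- exact: measurable_funeM.
- by move=> w _; apply: sume_ge0.
- exact: emeasurable_sum.
by rewrite ge0_integralZl_EFin// ge0_integral_sum.
Qed.

Lemma EtauE (R : realType) (d : measure_display)
    (T : measurableType d) (P : probability T R) (theta : R)
    (N : R -> T -> nat) (hN : poisson_process P theta N) (x : R) (m : nat) :
  0 < theta -> (forall j : nat, (x <= j%:R) = (m <= j)%N) ->
  Etau P N x = (m%:R / theta)%:E.
Proof.
move=> theta0 mx; rewrite /Etau -(expectation_arrival_time hN)//.
by apply: eq_integral => w _; rewrite (tauE hN w mx).
Qed.

Lemma EareaE (R : realType) (d : measure_display)
    (T : measurableType d) (P : probability T R) (theta : R)
    (N : R -> T -> nat) (hN : poisson_process P theta N) (x : R) (m : nat) :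
  0 < theta -> (forall j : nat, (x <= j%:R) = (m <= j)%N) ->
  Earea P N x = (area_weight m x / theta)%:E.
Proof.
move=> theta0; case: m => [|n] mx.
  rewrite /area_weight mulr0 big_ord0 addr0 mul0r /Earea integral0_eq// => w _.
  by rewrite area_nonpos//; exact: level0_nonpos.
transitivity (\int[P]_w (cst 1%E w * area N x w))%E.
  by apply: eq_integral => w _; rewrite mul1e.
have E i : (\int[P]_w (cst 1 w * arrival_time N i w) = (i%:R / theta)%:E)%E.
  rewrite -(expectation_arrival_time hN)//.
  by apply: eq_integral => w _; rewrite mul1e.
rewrite (integral_mul_area hN mx)// E.
under eq_bigr do rewrite E.
rewrite sumEFin -EFinM -EFinD; congr EFin.
by rewrite /area_weight/= [RHS]mulrDl mulrA mulr_suml.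
Qed.

Lemma VE (R : realType) (d : measure_display)
    (T : measurableType d) (P : probability T R) (theta : R)
    (N : R -> T -> nat) (hN : poisson_process P theta N) (x : R) (m : nat) :
  0 < theta -> (forall j : nat, (x <= j%:R) = (m <= j)%N) ->
  V P N x = (m.+1%:R * area_weight m x / theta ^+ 2)%:E.
Proof.
move=> theta0; case: m => [|n] mx.
  rewrite /area_weight mulr0 big_ord0 addr0 mulr0 mul0r /V integral0_eq// => w _.
  by rewrite area_nonpos ?mule0//; exact: level0_nonpos.
rewrite /V (integral_mul_area hN mx); last 2 first.
- exact: measurable_tau hN x.
- by move=> w; exact: tau_ge0.
(* The indices in the area formula never exceed the passage index [n.+1], so all product moments
   share the factor [n.+2]. *)
have E i : (i <= n.+1)%N -> (\int[P]_w (tau N x w * arrival_time N i w)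
    = ((i * n.+2)%:R / theta ^+ 2)%:E)%E.
  move=> iltn; rewrite -(expectation_arrival_time_mul hN)//.
  by apply: eq_integral => w _; rewrite (tauE hN w mx).
rewrite E// (eq_bigr (fun i : 'I_n => ((i.+1 * n.+2)%:R / theta ^+ 2)%:E));
  last first.
  by move=> i _; rewrite E// ltnW// ltnS.
rewrite sumEFin -EFinM -EFinD; congr EFin.
rewrite /area_weight/= mulrDr [RHS]mulrDl; congr (_ + _).
  by rewrite natrM !mulrA; congr (_ / _); ring.
rewrite mulr_sumr mulr_suml; apply: eq_bigr => i _.
by rewrite natrM [_ * n.+2%:R]mulrC.
Qed.

(** * Integrability, the difference equation and the limit *)

(** Lets the closed forms double as proofs of integrability. *)
Lemma ge0_integrable (R : realType) (d : measure_display)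
    (T : measurableType d) (mu : {measure set T -> \bar R})
    (f : T -> \bar R) (c : R) :
  measurable_fun setT f -> (forall w, 0 <= f w)%E ->
  (\int[mu]_w f w = c%:E)%E -> mu.-integrable setT f.
Proof.
move=> mf f0 fc; apply/integrableP; split=> //.
by under eq_integral do rewrite gee0_abs//; rewrite fc ltry.
Qed.

Lemma cvg_div_sqr_pinfty (R : realType) (c : R) :
  c / theta ^+ 2 @[theta --> +oo] --> 0.
Proof.
rewrite -[X in _ --> X](mulr0 c); apply: cvgMl_tmp.
apply/gtr0_cvgV0; last exact: cvgr_expr2.
by near=> theta; rewrite exprn_gt0.
Unshelve. all: by end_near. Qed.

Theorem theorem3p1 (R : realType) (d : R -> measure_display)
    (T : forall theta : R, measurableType (d theta))
    (P : forall theta : R, probability (T theta) R)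
    (N : forall theta : R, R -> T theta -> nat)
    (hN : forall theta : R, 0 < theta ->
      poisson_process (P theta) theta (N theta)) :
  (forall theta : R, 0 < theta ->
    [/\ forall x : R,
          [/\ (P theta).-integrable setT (tau (N theta) x),
              (P theta).-integrable setT (area (N theta) x) &
              (P theta).-integrable setT
                (fun w => tau (N theta) x w * area (N theta) x w)%E],
        forall x : R, 0 < x ->
          (theta%:E * (V (P theta) (N theta) (x - 1) - V (P theta) (N theta) x)
           = - (x%:E * Etau (P theta) (N theta) x)
             - Earea (P theta) (N theta) x)%E
      & forall y : R, y <= 0 -> V (P theta) (N theta) y = 0%E]) /\
  (forall x : R,
    V (P theta) (N theta) x @[theta --> +oo] --> (0 : \bar R)%E).
Proof.
split=> [theta theta0|x].
  have hNt := hN _ theta0; split=> [x|x x0|y y0].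
  - have [m mx] := exists_level x.
    have mtau := measurable_tau hNt x; have marea := measurable_area hNt x.
    have t0 := tau_ge0 (N theta) x; have a0 := area_ge0 hNt x.
    split.
    + exact: ge0_integrable mtau t0 (EtauE hNt theta0 mx).
    + exact: ge0_integrable marea a0 (EareaE hNt theta0 mx).
    + apply: ge0_integrable (VE hNt theta0 mx).
        exact: emeasurable_funM.
      by move=> w; rewrite mule_ge0.
  - have [[|m] mx] := exists_level x.
      by have := level0_nonpos mx; rewrite leNgt x0.
    (* Starting one unit lower reduces the level by exactly one. *)
    have mx1 j : (x - 1 <= j%:R) = (m <= j)%N.
      by rewrite lerBlDr natr1 mx.
    rewrite (VE hNt theta0 mx1) (VE hNt theta0 mx) (EtauE hNt theta0 mx).
    rewrite (EareaE hNt theta0 mx) -EFinB -!EFinM -EFinN -EFinB; congr EFin.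
    (* With [S] the weight of level [m] at [x - 1], both sides times [theta] equal
       [- S - (m + 2) x]; on the left this is [(m + 1) S - (m + 2) (S + x)]. *)
    rewrite area_weightS -(natr1 m.+1).
    by field; rewrite gt_eqF.
  - by rewrite /V integral0_eq// => w _; rewrite tau_nonpos// mul0e.
have [m mx] := exists_level x.
(* The level [m] depends on [x] alone, so one closed form serves all [theta > 0], hence a
   neighbourhood of [+oo]. *)
apply: (@cvg_trans _ ((m.+1%:R * area_weight m x / theta ^+ 2)%:E
    @[theta --> +oo])).
  apply: near_eq_cvg; near=> theta.
  have theta0 : 0 < theta by near: theta; apply: nbhs_pinfty_gt; exact: num_real.
  by rewrite (VE (hN _ theta0) theta0 mx).
by apply: cvg_EFin; [near=> theta|exact: cvg_div_sqr_pinfty].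
Unshelve. all: by end_near. Qed.
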